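(* For $N\ge 2$, OHM satisfies $$\rho\big(H_{\mathrm{OHM}}(N-1)\big)=\sum_{j=1}^{N-1}\lambda^\star_{j+1,j}\big(H_{\mathrm{OHM}}(N-1)\big)=\frac{N^2-1}{3},$$ and $H_{\mathrm{OHM}}(N-1)$ is the unique maximizer of $\rho(H)$ over basic optimal vertex algorithms $H\in\mathcal H_\star(N-1)$.
   Context: Algorithms. Let $N\ge 1$ be an integer. An H-matrix of size $N-1$ is a real lower triangular matrix $H=(h_{k,j})_{1\le j\le k\le N-1}$ (the empty matrix $[\,]$ for $N=1$). Given a real Hilbert space $\mathcal X$, an operator $T:\mathcal X\to\mathcal X$ and $y_0\in\mathcal X$, the algorithm defined by $H$ generates $y_{k+1}=y_k-\sum_{j=0}^{k}h_{k+1,j+1}(y_j-Ty_j)$ for $k=0,\dots,N-2$. $T$ is nonexpansive if $\|Tx-Ty\|\le\|x-y\|$ for all $x,y\in\mathcal X$; $y_\star$ is a fixed point if $Ty_\star=y_\star$. $\mathcal H_\star(N-1)$ is the set of H-matrices of size $N-1$ such that $\|y_{N-1}-Ty_{N-1}\|^2\le 4\|y_0-y_\star\|^2/N^2$ for every real Hilbert space $\mathcal X$, every nonexpansive $T:\mathcal X\to\mathcal X$ with a fixed point $y_\star$ and every $y_0\in\mathcal X$. OHM (Optimal Halpern Method): $H_{\mathrm{OHM}}(N-1)$ is the $(N-1)\times(N-1)$ lower triangular matrix with entries $-\frac{j}{k(k+1)}$ for $j<k$ and $\frac{k}{k+1}$ for $j=k$. H-certificates. For $m,j\in\{1,\dots,N-1\}$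 let $Q(m,j;H)=\sum\prod_{r=1}^m h_{i(r),j(r)}$, the sum over all integers $j=j(1)\le i(1)<j(2)\le i(2)<\cdots<j(m)\le i(m)\le N-1$ (an empty sum is $0$). The H-certificates of $H$ are $\lambda^\star_{N,j}(H)=N\sum_{m=1}^{N-1}(-1)^{m-1}Q(m,j;H)$ for $1\le j\le N-1$, and $\lambda^\star_{k,j}(H)=N\sum_{\ell=1}^{N-1}\sum_{m=1}^{N-1}(-1)^{\ell+m-1}\binom{\ell+m}{m}Q(\ell,j;H)Q(m,k;H)$ for $1\le j<k\le N-1$. Known fact (Yoon–Ryu–Grimmer): $H\in\mathcal H_\star(N-1)$ if and only if $\sum_{j=1}^{N-1}Q(k,j;H)=\frac1N\binom{N}{k+1}$ for $k=1,\dots,N-1$ and $\lambda^\star_{k,j}(H)\ge 0$ for all $1\le j<k\le N$. Define $\rho(H)=\sum_{j=1}^{N-1}\sum_{k=j+1}^{N}\lambda^\star_{k,j}(H)$. Vertices. An optimal vertex algorithm (vertex of $\mathcal H_\star(N-1)$) is an $H\in\mathcal H_\star(N-1)$ such that for each $j=1,\dots,N-1$ there is exactly one index $k(j)\in\{j+1,\dots,N\}$ with $\lambda^\star_{k(j),j}(H)>0$. Gluing and basic matrices. For $1\le N'\le N-1$, $H_1\in\mathcal H_\star(N'-1)$, $H_2\in\mathcal H_\star(N-N'-1)$, $H_1\bowtie H_2$ is the lower triangular $(N-1)\times(N-1)$ matrix with entries: $h_{k,j}=(H_1)_{k,j}$ for $1\le j\le k\le N'-1$; $h_{k,j}=(H_2)_{k-N',j-N'}$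 for $N'+1\le j\le k\le N-1$; $h_{k,j}=0$ for $j\le N'-1$, $k\ge N'+1$; $h_{N',j}=-\frac{N-N'}{N}\sum_{k=j}^{N'-1}(H_1)_{k,j}$ for $j\le N'-1$; $h_{N',N'}=\frac{N'(N-N')}{N}$; and $h_{N'+1,N'},\dots,h_{N-1,N'}$ are the unique values with $Q(m,N';H_1\bowtie H_2)=\frac{N'(N-N'+1)}{N(m+1)}\binom{N-N'-1}{m-1}$ for $m=1,\dots,N-N'$. The $0\times0$ matrix $[\,]$ is basic, and recursively an H-matrix is basic if it is a gluing $H_1\bowtie H_2$ of smaller basic H-matrices (basic matrices are optimal vertex algorithms). *)

(* Defs.v *)
From HB Require Import structures.
From mathcomp Require Import all_boot all_order all_algebra.
From mathcomp Require Import all_classical all_reals all_analysis.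
Import Order.TTheory GRing.Theory Num.Theory.
Import numFieldNormedType.Exports.

Set Implicit Arguments.
Unset Strict Implicit.
Unset Printing Implicit Defensive.

Local Open Scope ring_scope.

(* Throughout, N is the number of steps plus one: an H-matrix for N is a lower *)
(* triangular matrix of size N - 1. As N cannot be recovered from N.-1, it is  *)
(* always an explicit argument.                                               *)

(* h_{k,j} with indices starting at 1; 0 when k or j is not in 1..n. *)
Definition entry (R : realType) (n : nat) (H : 'M[R]_n) (k j : nat) : R :=
  if (insub k.-1 : option 'I_n, insub j.-1 : option 'I_n) is (Some a, Some b)
  then (if (0 < k)%N && (0 < j)%N then H a b else 0) else 0.

(* The norm of the Banach space X comes from an inner product; for idfun as   *)
(* conjugation, {dot X for idfun} are the symmetric positive definite         *)
(* bilinear forms.                                                            *)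
Definition is_hilbert (R : realType) (X : completeNormedModType R) : Prop :=
  exists dot : {dot X for idfun}, forall x : X, dot x x = `|x| ^+ 2.

Definition nonexpansive (R : realType) (X : completeNormedModType R)
    (T : X -> X) : Prop :=
  forall x y : X, `|T x - T y| <= `|x - y|.

(* The values y k with k >= N are irrelevant and left arbitrary. *)
Definition generates (R : realType) (N : nat) (H : 'M[R]_(N.-1))
    (X : completeNormedModType R) (T : X -> X) (y : nat -> X) : Prop :=
  forall k, (k < N.-1)%N ->
    y k.+1 = y k - \sum_(0 <= j < k.+1) entry H k.+1 j.+1 *: (y j - T (y j)).

Definition Hstar (R : realType) (N : nat) (H : 'M[R]_(N.-1)) : Prop :=
  is_trig_mx H /\
  forall X : completeNormedModType R, is_hilbert X ->
  forall T : X -> X, nonexpansive T ->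
  forall ystar : X, T ystar = ystar ->
  forall y : nat -> X, generates (N := N) H T y ->
    `|y N.-1 - T (y N.-1)| ^+ 2 <= 4 * `|y 0%N - ystar| ^+ 2 / N%:R ^+ 2.

Definition OHM (R : realType) (N : nat) : 'M[R]_(N.-1) :=
  \matrix_(a, b)
    let k := a.+1 in let j := b.+1 in
    if (j < k)%N then - (j%:R / (k * k.+1)%:R)
    else if j == k then k%:R / k.+1%:R
    else 0.

(* The r-th component of p is the pair (i(r), j(r)), with r, i(r) and j(r)    *)
(* counted from 0, whereas j is counted from 1.                               *)
Definition interlaced (n m j : nat) (p : {ffun 'I_m -> 'I_n * 'I_n}) : bool :=
  [&& [forall r : 'I_m, (r == 0%N :> nat) ==> ((p r).2.+1 == j)],
      [forall r : 'I_m, ((p r).2 <= (p r).1)%N]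
    & [forall r : 'I_m, forall s : 'I_m,
        (r.+1 == s :> nat) ==> ((p r).1 < (p s).2)%N]].

Definition Q (R : realType) (n : nat) (m j : nat) (H : 'M[R]_n) : R :=
  \sum_(p : {ffun 'I_m -> 'I_n * 'I_n} | interlaced j p)
    \prod_(r < m) H (p r).1 (p r).2.

Definition cert (R : realType) (N : nat) (H : 'M[R]_(N.-1)) (k j : nat) : R :=
  if k == N then
    N%:R * \sum_(1 <= m < N) (-1) ^+ m.-1 * Q m j H
  else
    N%:R * \sum_(1 <= l < N) \sum_(1 <= m < N)
      (-1) ^+ (l + m).-1 * 'C(l + m, m)%:R * Q l j H * Q m k H.

Definition rho (R : realType) (N : nat) (H : 'M[R]_(N.-1)) : R :=
  \sum_(1 <= j < N) \sum_(j.+1 <= k < N.+1) cert (N := N) H k j.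

Definition optimal_vertex (R : realType) (N : nat) (H : 'M[R]_(N.-1)) : Prop :=
  Hstar (N := N) H /\
  forall j, (1 <= j < N)%N ->
    exists! k, (j < k <= N)%N /\ 0 < cert (N := N) H k j.

(* H = H1 |><| H2. The last clause determines the entries of column N' below  *)
(* the diagonal, because H2 in Hstar has no zero on its diagonal.             *)
Definition is_gluing (R : realType) (N N' : nat) (H1 : 'M[R]_(N'.-1))
    (H2 : 'M[R]_((N - N').-1)) (H : 'M[R]_(N.-1)) : Prop :=
  [/\ (1 <= N' <= N.-1)%N, Hstar (N := N') H1, Hstar (N := N - N') H2
    & is_trig_mx H] /\
  [/\ forall k j, (1 <= j <= k)%N -> (k <= N'.-1)%N ->
        entry H k j = entry H1 k j,
      forall k j, (N'.+1 <= j <= k)%N -> (k <= N.-1)%N ->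
        entry H k j = entry H2 (k - N') (j - N'),
      forall k j, (1 <= j <= N'.-1)%N -> (N'.+1 <= k <= N.-1)%N ->
        entry H k j = 0
    & forall j, (1 <= j <= N'.-1)%N ->
        entry H N' j =
          - ((N - N')%:R / N%:R) * \sum_(j <= k < N') entry H1 k j] /\
  entry H N' N' = (N' * (N - N'))%:R / N%:R /\
  forall m, (1 <= m <= N - N')%N ->
    Q m N' H =
      (N' * (N - N').+1)%:R / (N * m.+1)%:R * 'C((N - N').-1, m.-1)%:R.

Inductive basic (R : realType) : forall N : nat, 'M[R]_(N.-1) -> Prop :=
| basic_empty : @basic R 1 0
| basic_gluing (N N' : nat) (H1 : 'M[R]_(N'.-1)) (H2 : 'M[R]_((N - N').-1))
    (H : 'M[R]_(N.-1)) :
    @basic R N' H1 -> @basic R (N - N') H2 ->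
    @is_gluing R N N' H1 H2 H -> @basic R N H.

Definition unique_maximizer (R : realType) (S : Type) (A : set S) (f : S -> R)
    (x : S) : Prop :=
  A x /\ forall z, A z -> z <> x -> f z < f x.

Arguments generates {R} N H {X} T y.
Arguments Hstar {R} N H.
Arguments OHM R N : clear implicits.
Arguments cert {R} N H k j.
Arguments rho {R} N H.
Arguments optimal_vertex {R} N H.
Arguments is_gluing {R} N N' H1 H2 H.
Arguments basic {R} N H.

(* Main.v *)
Require Import Defs.
From mathcomp Require Import all_boot all_order all_algebra.
From mathcomp Require Import all_classical all_reals all_analysis.
From mathcomp Require Import ring lra zify.
Set Implicit Arguments.
Unset Strict Implicit.
Unset Printing Implicit Defensive.
Import Order.TTheory GRing.Theory Num.Theory.
Local Open Scope classical_set_scope.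
Local Open Scope ring_scope.

(* Attach to index j the polynomial F_j(x) = sum_m Q(m,j;H) (x-1)^m, and put   *)
(* F_N = 1. By Vandermonde's identity, the pairing of (x-1)^l and (x-1)^m by   *)
(* coefficients is (-1)^(l+m) binom(l+m,m), so that                           *)
(* lambda_{k,j} = - N <F_j, F_k> for all j < k <= N. For a basic H, the sum of *)
(* all F_j is (1 + x + ... + x^(N-1)) / N, hence                              *)
(* 2 rho(H) + 1 = N sum_j |F_j|^2. Gluing H1 (of size a) and H2 (of size b)    *)
(* gives F_j = (a/N) x^b F1_j for j < a,                                      *)
(* F_a = (a/N) (x^b - (1 + ... + x^(b-1)) / b) and F_{a+j} = F2_j. The square  *)
(* norms thus satisfy an explicit recursion, from which                       *)
(* 2 rho(H) + 1 <= (2N^2+1)/3, with equality only if b = 1 in each gluing     *)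
(* along the left spine, that is, only for OHM.                               *)

(** The polynomials F_j are [genpoly]. The recursion [genpoly_rec] replaces the sums over chains in
    [Q] by linear relations among the F_j; from these, [genpoly_gluing_left], [genpoly_gluing_mid]
    and [genpoly_gluing_right] compute the effect of a gluing. With [cert_dotp] and [rho_sqnorm],
    maximizing rho means maximizing the sum of square norms, which [basic_sqnorm_le] does by
    induction over gluings. For OHM and j < N, [genpoly_OHM] gives F_j = (j/N) (x^(N-j) -
    x^(N-j-1)). Only neighbours share a monomial, so the only nonzero certificates are
    lambda_{j+1,j} = j(j+1)/N. Optimality of OHM is shown in [Hstar_OHM] by a Lyapunov argument for
    the Halpern iteration. *)

Definition ffcons {T : finType} {m : nat} (x : T) (q : {ffun 'I_m -> T}) :
    {ffun 'I_m.+1 -> T} :=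
  [ffun r => oapp q x (unlift ord0 r)].

Lemma ffcons0 (T : finType) m (x : T) (q : {ffun 'I_m -> T}) :
  ffcons x q ord0 = x.
Proof. by rewrite ffunE unlift_none. Qed.

Lemma ffconsS (T : finType) m (x : T) (q : {ffun 'I_m -> T}) (r : 'I_m) :
  ffcons x q (lift ord0 r) = q r.
Proof. by rewrite ffunE liftK. Qed.

Lemma ffcons_bij (T : finType) m :
  bijective (fun p : T * {ffun 'I_m -> T} => ffcons p.1 p.2).
Proof.
exists (fun p : {ffun 'I_m.+1 -> T} =>
  (p ord0, [ffun r : 'I_m => p (lift ord0 r)])) => [[x q]|p] /=.
  by rewrite ffcons0; congr (_, _); apply/ffunP => r; rewrite ffunE ffconsS.
apply/ffunP => r; case: (unliftP ord0 r) => [s ->|->].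
  by rewrite ffconsS ffunE.
by rewrite ffcons0.
Qed.

(** Prepending a pair adds only the conditions on that pair and its link to the next one. The last
    conjunct prescribes to [q] the starting column that [q] already has. *)
Lemma interlaced_ffcons n m j (x : 'I_n * 'I_n)
    (q : {ffun 'I_m.+1 -> 'I_n * 'I_n}) :
  interlaced j (ffcons x q) =
    [&& x.2.+1 == j, (x.2 <= x.1)%N, (x.1 < (q ord0).2)%N
      & interlaced (q ord0).2.+1 q].
Proof.
apply/and3P/and4P =>
  [[/forallP h1 /forallP h2 /forallP h3]
  |[e1 e2 e3 /and3P[/forallP h1 /forallP h2 /forallP h3]]].
  split.
  - by have := h1 ord0; rewrite ffcons0.
  - by have := h2 ord0; rewrite ffcons0.
  - by have /forallP/(_ (lift ord0 ord0)) := h3 ord0; rewrite ffcons0 ffconsS.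
  - apply/and3P; split; apply/forallP => r.
    + apply/implyP => r0; have -> : r = ord0 by apply/val_inj/eqP.
      by [].
    + by have := h2 (lift ord0 r); rewrite ffconsS.
    + apply/forallP => s; have /forallP/(_ (lift ord0 s)) := h3 (lift ord0 r).
      by rewrite !ffconsS !lift0 eqSS.
split; apply/forallP => r; case: (unliftP ord0 r) => [r' ->|->];
  rewrite ?ffcons0 ?ffconsS //.
  apply/forallP => s; case: (unliftP ord0 s) => [s' ->|->].
    have /forallP/(_ s') := h3 r'.
    by rewrite ffconsS !lift0 eqSS.
  by apply/implyP.
apply/forallP => s; case: (unliftP ord0 s) => [s' ->|->] //=.
rewrite (ffconsS x q s') /bump /= add1n; apply/implyP; rewrite eqSS eq_sym => s0.
by have -> : s' = ord0 by apply/val_inj/eqP.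
Qed.

Lemma Q_cons (R : realType) n m j (H : 'M[R]_n) :
  Q m.+1 j H = \sum_(x : 'I_n * 'I_n)
    H x.1 x.2 * \sum_(q : {ffun 'I_m -> 'I_n * 'I_n} | interlaced j (ffcons x q))
      \prod_(r < m) H (q r).1 (q r).2.
Proof.
rewrite /Q (reindex _ (onW_bij _ (ffcons_bij _ _))) /=.
under eq_bigr do rewrite big_ord_recl ffcons0.
under [RHS]eq_bigr do rewrite big_distrr /=.
rewrite [RHS]pair_big_dep /=.
apply: eq_bigr => p _; congr (_ * _); apply: eq_bigr => r _.
by rewrite ffconsS.
Qed.

Lemma Q1 (R : realType) n (H : 'M[R]_n) (a : 'I_n) :
  Q 1 a.+1 H = \sum_(i : 'I_n | (a <= i)%N) H i a.
Proof.
rewrite Q_cons.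
pose q0 : {ffun 'I_0 -> 'I_n * 'I_n} := [ffun r => (a, a)].
have il (x : 'I_n * 'I_n) (q : {ffun 'I_0 -> 'I_n * 'I_n}) :
    interlaced a.+1 (ffcons x q) = (x.2 == a) && (x.2 <= x.1)%N.
  apply/and3P/andP => [[/forallP h1 /forallP h2 _]|[/eqP h1 h2]].
    have := h1 ord0; have := h2 ord0; rewrite !ffcons0 /= eqSS => -> /eqP/val_inj ->.
    by rewrite eqxx.
  split; apply/forallP => r; rewrite (ord1 r) ?ffcons0 ?h1 //=.
    by rewrite -h1.
  by apply/forallP => s; rewrite (ord1 s).
transitivity (\sum_(x : 'I_n * 'I_n | (x.2 == a) && (x.2 <= x.1)%N) H x.1 x.2).
  rewrite [RHS]big_mkcond; apply: eq_bigr => x _.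
  under eq_bigl do rewrite il.
  case: ifP => _; last by rewrite big_pred0_eq mulr0.
  rewrite (big_pred1 q0) ?big_ord0 ?mulr1 // => q.
  by apply/esym/eqP/ffunP; case.
rewrite -(pair_big_dep xpredT (fun i b : 'I_n => (b == a) && (b <= i)%N)
  (fun i b => H i b)) /=.
rewrite [RHS]big_mkcond; apply: eq_bigr => i _.
by rewrite big_mkcondr big_pred1_eq.
Qed.

(** Chains are grouped by the row [i] of their first pair and the column [b] of their second; the
    rest is a shorter chain starting at [b]. *)
Lemma QSS (R : realType) n m (H : 'M[R]_n) (a : 'I_n) :
  Q m.+2 a.+1 H =
    \sum_(i : 'I_n | (a <= i)%N)
      H i a * \sum_(b : 'I_n | (i < b)%N) Q m.+1 b.+1 H.
Proof.
rewrite Q_cons.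
pose G (i : 'I_n) := \sum_(b : 'I_n | (i < b)%N) Q m.+1 b.+1 H.
transitivity (\sum_(x : 'I_n * 'I_n | (x.2 == a) && (x.2 <= x.1)%N)
    H x.1 x.2 * G x.1).
  rewrite [RHS]big_mkcond; apply: eq_bigr => x _.
  under eq_bigl do rewrite interlaced_ffcons eqSS andbA.
  rewrite -[(nat_of_ord _ == _)]/(x.2 == a).
  case: ifP => _ /=; last by rewrite big_pred0_eq mulr0.
  congr (_ * _); rewrite (partition_big
    (fun q : {ffun 'I_m.+1 -> 'I_n * 'I_n} => (q ord0).2)
    (fun b : 'I_n => (x.1 < b)%N)) /=; last first.
    by move=> q /andP[].
  apply: eq_bigr => b xb; rewrite /Q; apply: eq_bigl => q.
  apply/idP/idP => [/andP[/andP[_ h] /eqP <-] //|h].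
  have /eqP e : (q ord0).2 == b.
    by case/and3P: h => /forallP/(_ ord0) /=; rewrite eqSS.
  by rewrite e xb h eqxx.
rewrite -(pair_big_dep xpredT (fun i b : 'I_n => (b == a) && (b <= i)%N)
  (fun i b => H i b * G i)) /=.
rewrite [RHS]big_mkcond; apply: eq_bigr => i _.
by rewrite big_mkcondr big_pred1_eq.
Qed.

(** * Passage from ordinals to indices counted from 1 *)

Lemma entryE (R : realType) n (H : 'M[R]_n) (a b : 'I_n) :
  entry H a.+1 b.+1 = H a b.
Proof. by rewrite /entry /= !valK. Qed.

Lemma Q_out (R : realType) n m j (H : 'M[R]_n) : (n < j)%N -> Q m.+1 j H = 0.
Proof.
move=> nj; rewrite /Q big_pred0 // => p; apply/negbTE/negP => /and3P[].
move=> /forallP/(_ ord0)/= /eqP pj _ _.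
by have := ltn_ord (p ord0).2; rewrite ltnNge -ltnS pj nj.
Qed.

Lemma big_ord_geqS (V : nmodType) n a (G : nat -> V) :
  \sum_(i : 'I_n | (a <= i)%N) G i.+1 = \sum_(a.+1 <= i < n.+1) G i.
Proof.
rewrite big_add1 /= (big_nat_widenl _ 0) // big_mkord.
by apply: eq_bigl => i.
Qed.

Lemma Q1_nat (R : realType) n j (H : 'M[R]_n) : (0 < j)%N ->
  Q 1 j H = \sum_(j <= i < n.+1) entry H i j.
Proof.
case: j => // j _; have [jn|jn] := ltnP j n; last first.
  by rewrite Q_out // big_geq.
rewrite -(big_ord_geqS _ _ (fun i => entry H i j.+1)).
rewrite -[j]/(val (Ordinal jn)) Q1 /=.
by apply: eq_bigr => i _; rewrite -entryE.
Qed.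

Lemma QSS_nat (R : realType) n m j (H : 'M[R]_n) : (0 < j)%N ->
  Q m.+2 j H =
    \sum_(j <= i < n.+1) entry H i j * \sum_(i.+1 <= b < n.+1) Q m.+1 b H.
Proof.
case: j => // j _; have [jn|jn] := ltnP j n; last first.
  by rewrite Q_out // big_geq.
rewrite -(big_ord_geqS _ _
  (fun i => entry H i j.+1 * \sum_(i.+1 <= b < n.+1) Q m.+1 b H)).
rewrite -[j in LHS]/(val (Ordinal jn)) QSS /=.
apply: eq_bigr => i _; rewrite -entryE; congr (_ * _).
exact: (big_ord_geqS _ _ (fun b => Q m.+1 b H)).
Qed.

(** The columns of a chain increase strictly, so [m.+1] pairs starting at column [j] reach column
    [m + j] or beyond. *)
Lemma Q_oversize (R : realType) n m j (H : 'M[R]_n) :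
  (0 < j)%N -> (n < m + j)%N -> Q m.+1 j H = 0.
Proof.
elim: m j => [|m IH] j j0 nj; first by rewrite Q_out.
rewrite QSS_nat // big_nat big1 // => i /andP[ji iN].
rewrite big_nat big1 ?mulr0 // => b /andP[ib bN].
by rewrite IH //; lia.
Qed.

(** * The polynomials attached to the columns *)

(* The generating function of [m |-> Q m j H] at ['X - 1]; with the value 1 at *)
(* [j = N], the case [k = N] of [cert] is no longer special (see [cert_dotp]). *)
Definition genpoly (R : realType) (N : nat) (H : 'M[R]_(N.-1)) (j : nat) :
    {poly R} :=
  if j == N then 1 else \sum_(1 <= m < N) Q m j H *: ('X - 1) ^+ m.

Arguments genpoly {R} N H j.

Lemma genpolyN (R : realType) N (H : 'M[R]_(N.-1)) : genpoly N H N = 1.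
Proof. by rewrite /genpoly eqxx. Qed.

Lemma genpoly_lt (R : realType) N (H : 'M[R]_(N.-1)) j : (j < N)%N ->
  genpoly N H j = \sum_(1 <= m < N) Q m j H *: ('X - 1) ^+ m.
Proof. by move=> jN; rewrite /genpoly ltn_eqF. Qed.

(** This is [QSS_nat] on generating functions: the first pair contributes the factor ['X - 1], and
    the value 1 at [b = N] accounts for chains that end after it. *)
Lemma genpoly_rec (R : realType) N (H : 'M[R]_(N.-1)) j : (0 < j < N)%N ->
  genpoly N H j =
    ('X - 1) * \sum_(j <= i < N)
      entry H i j *: \sum_(i.+1 <= b < N.+1) genpoly N H b.
Proof.
case: N H => [|n] H /=; first by rewrite andbF.
move=> /andP[j0 jn]; set Y := 'X - 1.
have tail i : (j <= i < n.+1)%N ->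
    \sum_(i.+1 <= b < n.+2) genpoly n.+1 H b =
      1 + \sum_(0 <= m < n) (\sum_(i.+1 <= b < n.+1) Q m.+1 b H) *: Y ^+ m.+1.
  move=> /andP[ji iN]; rewrite big_nat_recr //= genpolyN addrC; congr (_ + _).
  under [RHS]eq_bigr do rewrite scaler_suml.
  rewrite exchange_big /= big_nat [RHS]big_nat; apply: eq_bigr => b /andP[_ bN].
  by rewrite genpoly_lt // big_add1.
rewrite (eq_big_nat _ _ (fun i h => congr1 _ (tail i h))).
under eq_bigr do rewrite scalerDr.
rewrite big_split /= mulrDr genpoly_lt // big_add1 /=.
(* The added top term vanishes; it makes room for splitting off the chains of length one. *)
transitivity (\sum_(0 <= m < n.+1) Q m.+1 j H *: Y ^+ m.+1).
  by rewrite big_nat_recr //= Q_oversize ?scale0r ?addr0 //; lia.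
rewrite [LHS]big_nat_recl // Q1_nat // -scaler_suml -scalerAr mulr1; congr (_ + _).
under [X in Y * X]eq_bigr do rewrite scaler_sumr.
rewrite exchange_big mulr_sumr; apply: eq_bigr => m _.
rewrite QSS_nat // scaler_suml mulr_sumr; apply: eq_bigr => i _.
by rewrite scalerA -scalerAr -exprS.
Qed.

(** * The coefficient pairing and the certificates *)

(** The truncation at [d] is harmless once one argument has size at most [d], see [dotp_widen]. *)
Definition dotp (R : realType) (d : nat) (f g : {poly R}) : R :=
  \sum_(i < d) f`_i * g`_i.

Lemma dotpC (R : realType) d (f g : {poly R}) : dotp d f g = dotp d g f.
Proof. by apply: eq_bigr => i _; rewrite mulrC. Qed.

Lemma dotpDl (R : realType) d (f g h : {poly R}) :
  dotp d (f + g) h = dotp d f h + dotp d g h.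
Proof. by rewrite -big_split; apply: eq_bigr => i _; rewrite coefD mulrDl. Qed.

Lemma dotpZl (R : realType) d c (f g : {poly R}) :
  dotp d (c *: f) g = c * dotp d f g.
Proof. by rewrite mulr_sumr; apply: eq_bigr => i _; rewrite coefZ mulrA. Qed.

Lemma dotp0l (R : realType) d (f : {poly R}) : dotp d 0 f = 0.
Proof. by apply: big1 => i _; rewrite coef0 mul0r. Qed.

Lemma dotpZr (R : realType) d c (f g : {poly R}) :
  dotp d g (c *: f) = c * dotp d g f.
Proof. by rewrite !(dotpC d g) dotpZl. Qed.

Lemma dotpBl (R : realType) d (f g h : {poly R}) :
  dotp d (f - g) h = dotp d f h - dotp d g h.
Proof. by rewrite -scaleN1r dotpDl dotpZl mulN1r. Qed.

Lemma dotpBr (R : realType) d (f g h : {poly R}) :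
  dotp d h (f - g) = dotp d h f - dotp d h g.
Proof. by rewrite !(dotpC d h) dotpBl. Qed.

Lemma dotp_suml (R : realType) d I (r : seq I) (G : I -> {poly R}) g :
  dotp d (\sum_(i <- r) G i) g = \sum_(i <- r) dotp d (G i) g.
Proof.
elim: r => [|i r IH]; first by rewrite !big_nil dotp0l.
by rewrite !big_cons dotpDl IH.
Qed.

Lemma dotp_sumr (R : realType) d I (r : seq I) (G : I -> {poly R}) g :
  dotp d g (\sum_(i <- r) G i) = \sum_(i <- r) dotp d g (G i).
Proof. by rewrite dotpC dotp_suml; apply: eq_bigr => i _; rewrite dotpC. Qed.

Lemma coef_Xsub1_exp (R : realType) l i :
  (('X - 1 : {poly R}) ^+ l)`_i = (-1) ^+ (l - i) * 'C(l, i)%:R.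
Proof.
rewrite addrC exprDn coef_sum.
under eq_bigr => k _ do
  rewrite coefMn -polyC1 -polyCN -polyC_exp coefCM coefXn mulr_natr.
have [il|li] := leqP i l; last first.
  rewrite bin_small // mulr0 big1 // => k _.
  by rewrite gtn_eqF ?mul0rn // (leq_trans (ltn_ord k)).
rewrite (bigD1 (inord i)) //= big1 => [|k]; last first.
  rewrite -val_eqE /= inordK ?ltnS // eq_sym => /negbTE ->.
  by rewrite mul0rn.
by rewrite inordK ?ltnS // eqxx addr0 mulr_natr.
Qed.

(** The signs combine to the constant (-1)^(l+m), since (l-i) + (m-i) and l + m have the same
    parity. Replacing binom(l,i) by binom(l,l-i) then gives Vandermonde's sum; [l < d] ensures that
    no term is cut off. *)
Lemma dotp_Xsub1_exp (R : realType) d l m : (l < d)%N ->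
  dotp d (('X - 1 : {poly R}) ^+ l) (('X - 1) ^+ m) =
    (-1) ^+ (l + m) * 'C(l + m, m)%:R.
Proof.
move=> ld.
transitivity (\sum_(0 <= i < d)
    (-1) ^+ (l + m) * ('C(m, i) * 'C(l, i))%:R : R).
  rewrite big_mkord; apply: eq_bigr => i _; rewrite !coef_Xsub1_exp.
  have [il|li] := leqP i l; last by rewrite (bin_small li) muln0 !(mulr0, mul0r).
  have [im|mi] := leqP i m; last by rewrite (bin_small mi) mul0n !(mulr0, mul0r).
  rewrite mulrACA -exprD natrM [X in _ * X]mulrC; congr (_ * _).
  rewrite -[LHS]signr_odd -[RHS]signr_odd; congr (_ ^+ nat_of_bool _).
  by lia.
rewrite -mulr_sumr -natr_sum (@big_cat_nat _ _ _ l.+1) //=.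
have -> : (\sum_(l.+1 <= i < d) 'C(m, i) * 'C(l, i) = 0)%N.
  by rewrite big_nat big1 // => i /andP[li _]; rewrite (bin_small li) muln0.
rewrite addn0 big_mkord; congr (_ * _%:R).
transitivity (\sum_(i < l.+1) 'C(m, i) * 'C(l, l - i))%N.
  by apply: eq_bigr => i _; rewrite bin_sub // -ltnS.
by rewrite binomial.Vandermonde -[in LHS]bin_sub ?leq_addl // addnK addnC.
Qed.

Lemma cert_dotp (R : realType) N (H : 'M[R]_(N.-1)) k j :
  (0 < j)%N -> (j < k <= N)%N ->
  cert N H k j = - N%:R * dotp N (genpoly N H j) (genpoly N H k).
Proof.
move=> j0 /andP[jk kN]; rewrite /cert mulNr -mulrN.
rewrite genpoly_lt ?(leq_trans jk) // dotp_suml.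
have sgn p : (0 < p)%N -> (-1) ^+ p.-1 = - (-1) ^+ p :> R.
  by case: p => // p _; rewrite exprS mulN1r opprK.
case: eqP => [->|/eqP kN'].
  rewrite genpolyN -sumrN; congr (_ * _); apply: eq_big_nat => m /andP[m0 mN].
  (* The constant 1 is read as the zeroth power of ['X - 1]. *)
  rewrite dotpZl -(expr0 ('X - 1)) dotp_Xsub1_exp // addn0 bin0 mulr1 sgn //.
  by rewrite mulNr mulrC.
rewrite genpoly_lt ?ltn_neqAle ?kN' // -sumrN; congr (_ * _).
apply: eq_big_nat => l /andP[l0 lN].
rewrite dotpZl dotp_sumr mulr_sumr -sumrN; apply: eq_big_nat => m /andP[m0 mN].
rewrite dotpZr dotp_Xsub1_exp // sgn ?addn_gt0 ?l0 //.
by set c := _%:R; ring.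
Qed.

Lemma sum_symmetric (V : zmodType) n (G : nat -> nat -> V) :
  (forall j k, G j k = G k j) ->
  \sum_(1 <= j < n.+1) \sum_(1 <= k < n.+1) G j k =
    \sum_(1 <= j < n.+1) G j j +
    (\sum_(1 <= j < n.+1) \sum_(j.+1 <= k < n.+1) G j k) *+ 2.
Proof.
move=> Gsym; elim: n => [|n IH]; first by rewrite !big_geq // mul0rn addr0.
have -> : \sum_(1 <= j < n.+2) \sum_(j.+1 <= k < n.+2) G j k =
    \sum_(1 <= j < n.+1) \sum_(j.+1 <= k < n.+1) G j k +
    \sum_(1 <= j < n.+1) G j n.+1.
  rewrite big_nat_recr //= [X in _ + X]big_geq // addr0 -big_split.
  by apply: eq_big_nat => j /andP[_ jn]; rewrite big_nat_recr.
have -> : \sum_(1 <= j < n.+2) \sum_(1 <= k < n.+2) G j k =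
    \sum_(1 <= j < n.+1) \sum_(1 <= k < n.+1) G j k +
    (\sum_(1 <= j < n.+1) G j n.+1) *+ 2 + G n.+1 n.+1.
  rewrite big_nat_recr //= [X in _ + X]big_nat_recr //= addrA mulr2n addrA.
  under [X in X + _ + _ = _]eq_bigr do rewrite big_nat_recr //=.
  by rewrite big_split /=; under [X in _ + X + _ = _]eq_bigr do rewrite Gsym.
by rewrite IH [X in _ = X + _]big_nat_recr //= mulrnDl addrAC -addrA addrACA addrA.
Qed.

(** * Normalized sums, and rho as a square norm *)

Definition geom (R : realType) (n : nat) : {poly R} := \sum_(0 <= i < n) 'X^i.
Arguments geom R n : clear implicits.

Lemma coef_geom (R : realType) n i : (geom R n)`_i = (i < n)%N%:R.
Proof.
rewrite coef_sum; under eq_bigr do rewrite coefXn eq_sym.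
have [ltin|lenI] := ltnP i n; last first.
  by rewrite big_nat big1 // => k /andP[_ kn]; rewrite ltn_eqF // (leq_trans kn).
rewrite big_mkord (bigD1 (Ordinal ltin)) //= eqxx big1 ?addr0 // => k.
by rewrite -val_eqE /= => /negbTE ->.
Qed.

Lemma geomD (R : realType) m n : geom R (m + n) = geom R m + 'X^m * geom R n.
Proof.
rewrite /geom (@big_cat_nat _ _ _ m) ?leq_addr //= mulr_sumr; congr (_ + _).
rewrite -{1}[m]add0n big_addn addKn.
by apply: eq_bigr => i _; rewrite -exprD addnC.
Qed.

Lemma geom1 (R : realType) : geom R 1 = 1.
Proof. by rewrite /geom big_nat1 expr0. Qed.

(** In powers of ['X - 1] (see [geom_Xsub1]), these are the optimality equations: the sum over j of
    Q(m,j;H) equals binom(N,m+1)/N. *)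
Definition sum_normalized (R : realType) (N : nat) (H : 'M[R]_(N.-1)) : Prop :=
  \sum_(1 <= b < N.+1) genpoly N H b = N%:R^-1 *: geom R N.
Arguments sum_normalized {R} N H.

Definition sqnorm (R : realType) (N : nat) (H : 'M[R]_(N.-1)) : R :=
  \sum_(1 <= j < N.+1) dotp N (genpoly N H j) (genpoly N H j).
Arguments sqnorm {R} N H.

Lemma dotp_geom (R : realType) n : dotp n (geom R n) (geom R n) = n%:R.
Proof.
rewrite /dotp (eq_bigr (fun=> 1)); first by rewrite sumr_const card_ord.
by move=> i _; rewrite coef_geom ltn_ord mulr1.
Qed.

(** The sum of all F_j has square norm 1/N. Expanding it gives the diagonal [sqnorm] plus twice the
    sum over j < k, which is -rho/N. *)
Lemma rho_sqnorm (R : realType) N (H : 'M[R]_(N.-1)) : (0 < N)%N ->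
  sum_normalized N H -> rho N H = (N%:R * sqnorm N H - 1) / 2.
Proof.
move=> N0 sumH; have N0' : N%:R != 0 :> R by rewrite pnatr_eq0 -lt0n.
pose U := \sum_(1 <= j < N.+1) \sum_(j.+1 <= k < N.+1)
  dotp N (genpoly N H j) (genpoly N H k).
have rhoU : rho N H = - N%:R * U.
  rewrite /U big_nat_recr //= [X in _ + X]big_geq // addr0 mulr_sumr.
  apply: eq_big_nat => j /andP[j0 jN]; rewrite mulr_sumr.
  by apply: eq_big_nat => k jk; rewrite cert_dotp.
have : N%:R^-1 = sqnorm N H + U *+ 2.
  rewrite -sum_symmetric => [|j k]; last by rewrite dotpC.
  under eq_bigr do rewrite -dotp_sumr.
  rewrite -dotp_suml sumH dotpZl dotpZr dotp_geom mulVf // mulr1 //.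
rewrite rhoU => e; have {e} -> : sqnorm N H = N%:R^-1 - U *+ 2 by rewrite e addrK.
by field.
Qed.

Lemma size_genpoly (R : realType) N (H : 'M[R]_(N.-1)) j :
  (0 < N)%N -> (size (genpoly N H j) <= N)%N.
Proof.
move=> N0; rewrite /genpoly; case: eqP => _; first by rewrite size_poly1.
rewrite big_nat; apply: (leq_trans (size_sum _ _ _)).
apply/bigmax_leqP_seq => m _ /andP[_ mN].
apply: (leq_trans (size_scale_leq _ _)).
by rewrite -polyC1 size_exp_XsubC.
Qed.

Lemma dotp_widen (R : realType) d e (f g : {poly R}) :
  (size f <= d)%N -> (d <= e)%N -> dotp e f g = dotp d f g.
Proof.
move=> fd de; rewrite /dotp -!(big_mkord xpredT (fun i => f`_i * g`_i)).
rewrite (@big_cat_nat _ _ _ d) //= [X in _ + X]big_nat [X in _ + X]big1 ?addr0 //.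
by move=> i /andP[di _]; rewrite nth_default ?mul0r // (leq_trans fd).
Qed.

Lemma dotp_mulXn (R : realType) b d (f g : {poly R}) :
  dotp (b + d) ('X^b * f) ('X^b * g) = dotp d f g.
Proof.
rewrite /dotp big_split_ord /= big1 ?add0r => [|i _].
  by apply: eq_bigr => i _; rewrite !coefXnM ltnNge leq_addr /= addKn.
by rewrite coefXnM ltn_ord mul0r.
Qed.

Lemma Xn_Xsub1 (R : realType) n :
  'X^n = \sum_(0 <= m < n.+1) ('X - 1 : {poly R}) ^+ m *+ 'C(n, m).
Proof.
by rewrite -{1}['X](subrK 1) exprD1n big_mkord.
Qed.

(** Expand x^n - 1 in powers of x - 1 and cancel one factor x - 1. *)
Lemma geom_Xsub1 (R : realType) n :
  geom R n = \sum_(0 <= m < n) 'C(n, m.+1)%:R *: ('X - 1) ^+ m.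
Proof.
apply: (@mulfI _ ('X - 1)); first by rewrite -polyC1 polyXsubC_eq0.
rewrite -[geom R n]/(\sum_(0 <= i < n) 'X^i) big_mkord -subrX1.
rewrite Xn_Xsub1 big_ltn // expr0 bin0 mulr1n addrC addKr big_add1 mulr_sumr.
by apply: eq_bigr => i _; rewrite -scalerAr -exprS scaler_nat.
Qed.

(** * The effect of a gluing on the polynomials *)

Section Gluing.
Variables (R : realType) (N a : nat).
Variables (H1 : 'M[R]_(a.-1)) (H2 : 'M[R]_((N - a).-1)) (H : 'M[R]_(N.-1)).
Hypothesis glH : is_gluing N a H1 H2 H.
Local Notation b := (N - a)%N.

Let a0 : (0 < a)%N. Proof. by case: glH => -[/andP[]]. Qed.
Let aN : (a < N)%N. Proof. by case: glH => -[/andP[? ?] _ _ _] _; lia. Qed.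

(** By [genpoly_rec], each polynomial depends only on later indices, where the entries are those of
    [H2]; hence the downward induction. *)
Lemma genpoly_gluing_right j : (0 < j <= b)%N ->
  genpoly N H (j + a) = genpoly b H2 j.
Proof.
have [d] := ubnP (b - j); elim: d j => // d IH j jd jb.
have [jb'|] := ltnP j b; last first.
  move=> bj; have -> : j = b by lia.
  by rewrite subnK ?genpolyN // ltnW.
rewrite !genpoly_rec; [|lia..].
rewrite big_addn; congr (_ * _); apply: eq_big_nat => i ij.
have [_ [[_ e2 _ _] _]] := glH.
rewrite e2; [|lia..]; rewrite !addnK; congr (_ *: _).
rewrite -addSn big_addn subSn ?(ltnW aN) //.
by apply: eq_big_nat => k ik; apply: IH; lia.
Qed.

(** The prescribed values of Q(m,a) are the coefficients of this polynomial in powers of x - 1: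
    binom(b,m) - binom(b,m+1)/b = (b+1)/(m+1) binom(b-1,m-1). *)
Lemma genpoly_gluing_mid :
  genpoly N H a = (a%:R / N%:R) *: ('X^b - b%:R^-1 *: geom R b).
Proof.
have [_ [_ [_ Qm]]] := glH.
rewrite genpoly_lt // geom_Xsub1 Xn_Xsub1.
set Y : {poly R} := 'X - 1; have b0 : (0 < b)%N by lia.
rewrite (@big_cat_nat _ _ _ b.+1) //=; last by lia.
(* Beyond [m = b] no chain starting in column [a] fits. *)
rewrite [X in _ + X]big_nat [X in _ + X]big1 ?addr0 => [|m /andP[bm mN]]; last first.
  by case: m bm mN => // m bm mN; rewrite Q_oversize ?scale0r //; lia.
have -> : \sum_(0 <= m < b) 'C(b, m.+1)%:R *: Y ^+ m =
    \sum_(0 <= m < b.+1) 'C(b, m.+1)%:R *: Y ^+ m.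
  by rewrite [RHS]big_nat_recr //= bin_small // scale0r addr0.
rewrite scaler_sumr -sumrB scaler_sumr [RHS]big_ltn // bin0 bin1 scalerA.
rewrite mulVf; last first.
  by rewrite pnatr_eq0 -lt0n.
rewrite mulr1n scale1r subrr scaler0 add0r; apply: eq_big_nat => m /andP[m0 mb].
rewrite Qm ?m0 // -[Y ^+ m *+ _]scaler_nat scalerA -scalerBl scalerA; congr (_ *: _).
case: m m0 mb => // m _ mb.
have := mul_bin_diag b m; have := mul_bin_left b m.+1.
move=> /(congr1 (fun n => n%:R : R)) h2 /(congr1 (fun n => n%:R : R)) h1.
move: h1 h2; rewrite !natrM (@natrB _ b m.+1) //= => h1 h2.
have Nn0 : N%:R != 0 :> R by rewrite pnatr_eq0; lia.
have bn0 : b%:R != 0 :> R by rewrite pnatr_eq0; lia.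
have m1n0 : m.+1%:R != 0 :> R by rewrite pnatr_eq0.
have m2n0 : m.+2%:R != 0 :> R by rewrite pnatr_eq0.
have -> : 'C(b, m.+2)%:R = (b%:R - m.+1%:R) * 'C(b, m.+1)%:R / m.+2%:R :> R.
  by rewrite -h2 mulrAC mulfV // mul1r.
have -> : 'C(b, m.+1)%:R = b%:R * 'C(b.-1, m)%:R / m.+1%:R :> R.
  by rewrite h1 mulrAC mulfV // mul1r.
by field; rewrite -natrD nat1r Nn0 bn0 !pnatr_eq0.
Qed.

Hypothesis sumH2 : sum_normalized b H2.

Let tail_right : \sum_(a.+1 <= k < N.+1) genpoly N H k = b%:R^-1 *: geom R b.
Proof.
rewrite -sumH2 -[a.+1]addn1 addnC big_addn subSn ?(ltnW aN) //.
by apply: eq_big_nat => k kb; rewrite genpoly_gluing_right.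
Qed.

(** The polynomial at [a] supplies the shifted term for F1_a = 1 and -a/(Nb) times [geom R b]; with
    1/b from the right block this leaves 1/N, as a + b = N. The second premise is the induction
    hypothesis of [genpoly_gluing_left]. *)
Let tail_left i : (i < a)%N ->
  (forall k, (i < k < a)%N ->
     genpoly N H k = (a%:R / N%:R) *: ('X^b * genpoly a H1 k)) ->
  \sum_(i.+1 <= k < N.+1) genpoly N H k =
    (a%:R / N%:R) *: ('X^b * \sum_(i.+1 <= k < a.+1) genpoly a H1 k) +
    N%:R^-1 *: geom R b.
Proof.
move=> ia IH; rewrite (@big_cat_nat _ _ _ a.+1) /=; [|lia..].
rewrite tail_right !big_nat_recr //= genpolyN genpoly_gluing_mid (eq_big_nat _ _ IH).
rewrite -scaler_sumr -mulr_sumr mulrDr mulr1 scalerBr scalerDr -!addrA.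
do 2!congr (_ + _); rewrite scalerA -scaleNr -scalerDl.
congr (_ *: _).
have Nn0 : N%:R != 0 :> R by rewrite pnatr_eq0; lia.
have bn0 : b%:R != 0 :> R by rewrite pnatr_eq0; lia.
rewrite (_ : a%:R = N%:R - b%:R :> R); last by rewrite natrB ?(ltnW aN) // subKr.
by field; rewrite bn0 Nn0.
Qed.

(** Each row from [j] to [a - 1] contributes its entry times (1/N) [geom R b]. Row [a] is chosen so
    that its contribution cancels their sum. *)
Lemma genpoly_gluing_left j : (0 < j < a)%N ->
  genpoly N H j = (a%:R / N%:R) *: ('X^b * genpoly a H1 j).
Proof.
have [d] := ubnP (a - j); elim: d j => // d IH j jd ja.
have [_ [[e1 _ e3 e4] _]] := glH.
rewrite !genpoly_rec; [|lia..].
rewrite (@big_cat_nat _ _ _ a) /=; [|lia..].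
rewrite (big_ltn aN) [X in _ + (_ + X)]big_nat [X in _ + (_ + X)]big1; last first.
  by move=> i ia; rewrite e3 ?scale0r //; lia.
rewrite addr0 tail_right e4; last by lia.
rewrite mulNr scaleNr -(scalerA (b%:R / N%:R)) scaler_suml.
transitivity (('X - 1) * ((a%:R / N%:R) *: ('X^b * (\sum_(j <= i < a)
    entry H1 i j *: (\sum_(i.+1 <= k < a.+1) genpoly a H1 k))))).
  congr (_ * _); rewrite mulr_sumr (scaler_sumr (b%:R / N%:R)).
  rewrite (scaler_sumr (a%:R / N%:R)) -sumrB.
  apply: eq_big_nat => i ij.
  rewrite e1 ?tail_left; [|lia|move=> k ik; apply: IH; lia|lia..].
  rewrite scalerDr -scalerAr !scalerA -addrA -scalerBl mulrC.
  rewrite [X in _ + X *: _](_ : _ = 0) ?scale0r ?addr0 //.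
  have Nn0 : N%:R != 0 :> R by rewrite pnatr_eq0; lia.
  have bn0 : b%:R != 0 :> R by rewrite pnatr_eq0; lia.
  by field; rewrite bn0 Nn0.
by rewrite -scalerAr mulrCA.
Qed.

Lemma sum_normalized_gluing : sum_normalized a H1 -> sum_normalized N H.
Proof.
move=> sumH1; rewrite /sum_normalized tail_left //; last first.
  by move=> k ka; rewrite genpoly_gluing_left.
rewrite sumH1 -scalerAr scalerA -[in RHS](subnK (ltnW aN)) geomD scalerDr addrC.
rewrite subnK ?(ltnW aN) //; congr (_ + _ *: _).
have an0 : a%:R != 0 :> R by rewrite pnatr_eq0; lia.
by rewrite mulrAC mulfV // mul1r.
Qed.

(** Up to the factor a/N, the coefficients are 1 in degree b and -1/b in the b lower degrees. *)
Let dotp_mid : dotp N (genpoly N H a) (genpoly N H a) =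
  (a%:R / N%:R) ^+ 2 * (1 + b%:R^-1).
Proof.
have bn0 : b%:R != 0 :> R by rewrite pnatr_eq0; lia.
rewrite genpoly_gluing_mid dotpZl dotpZr mulrA -expr2; congr (_ * _).
rewrite /dotp -!(big_mkord xpredT
  (fun i => ('X^b - b%:R^-1 *: geom R b)`_i * ('X^b - b%:R^-1 *: geom R b)`_i)).
rewrite (@big_cat_nat _ _ _ b) ?leq_subr //= addrC big_ltn; last by lia.
rewrite [X in _ + X + _]big_nat [X in _ + X + _]big1 => [|i /andP[bi iN]]; last first.
  by rewrite coefB coefXn coefZ coef_geom gtn_eqF // ltnNge ltnW //= mulr0 subrr mul0r.
rewrite addr0 coefB coefXn coefZ coef_geom eqxx ltnn mulr0 subr0 mulr1; congr (_ + _).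
rewrite (eq_big_nat _ _ (F2 := fun=> b%:R^-1 ^+ 2)) => [|i /andP[_ ib]]; last first.
  by rewrite coefB coefXn coefZ coef_geom ltn_eqF // ib mulr1 sub0r mulrNN.
by rewrite sumr_const_nat subn0 -[LHS]mulr_natr expr2 -mulrA mulVf ?mulr1.
Qed.

(** Multiplication by x^b preserves norms. At index [a], the norm 1 of F1_a becomes 1 + 1/b before
    scaling, whence the extra 1/b. *)
Lemma sqnorm_gluing :
  sqnorm N H = (a%:R / N%:R) ^+ 2 * (sqnorm a H1 + b%:R^-1) + sqnorm b H2.
Proof.
rewrite /sqnorm (@big_cat_nat _ _ _ a.+1) //=; [|lia..]; congr (_ + _); last first.
  rewrite -[a.+1]addn1 addnC big_addn subSn ?(ltnW aN) //.
  apply: eq_big_nat => j jb; rewrite genpoly_gluing_right; last by lia.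
  by rewrite (@dotp_widen _ b) ?leq_subr // size_genpoly //; lia.
have dotp11 : dotp a 1 1 = 1 :> R.
  rewrite /dotp; case: (a) a0 => // n _.
  by rewrite big_ord_recl !coef1 mulr1 big1 ?addr0 // => i _; rewrite coef1 mul0r.
rewrite !big_nat_recr //= dotp_mid genpolyN dotp11 -(addrA _ 1) [RHS]mulrDr.
congr (_ + _).
rewrite mulr_sumr; apply: eq_big_nat => j ja; rewrite genpoly_gluing_left //.
rewrite dotpZl dotpZr mulrA -expr2; congr (_ * _).
by rewrite -{1}(subnK (ltnW aN)) dotp_mulXn.
Qed.

End Gluing.

(** The equation on [n] admits sizes such as [n.+1 - n], which are not convertible to 1. *)
Lemma sum_normalized1 (R : realType) n (H : 'M[R]_(n.-1)) :
  n = 1%N -> sum_normalized n H.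
Proof.
move=> n1; subst n; by rewrite /sum_normalized big_nat1 genpolyN geom1 invr1 scale1r.
Qed.

Lemma sqnorm1 (R : realType) n (H : 'M[R]_(n.-1)) : n = 1%N -> sqnorm n H = 1.
Proof.
move=> n1; subst n.
by rewrite /sqnorm big_nat1 genpolyN /dotp big_ord1 coef1 mulr1.
Qed.

Lemma basic_sum_normalized (R : realType) N (H : 'M[R]_(N.-1)) :
  basic N H -> sum_normalized N H.
Proof.
elim=> [|M N' H1 H2 H' _ s1 _ s2 gl]; first exact: sum_normalized1.
exact: (sum_normalized_gluing gl).
Qed.

(** * Entries of OHM, and gluings with the empty matrix on the right *)

(** The entries do not depend on N, so OHM of one size is a leading block of the next. *)
Definition OHM_coef (R : realType) (k j : nat) : R :=
  if (j < k)%N then - (j%:R / (k * k.+1)%:R)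
  else if j == k then k%:R / k.+1%:R else 0.
Arguments OHM_coef R k j : clear implicits.

Lemma entry_OHM (R : realType) N k j : (0 < j <= k)%N -> (k < N)%N ->
  entry (OHM R N) k j = OHM_coef R k j.
Proof.
case: k j => [|k] [|j] // /andP[_ jk] kN; rewrite ltnS in jk.
have kN' : (k < N.-1)%N by lia.
rewrite -[k]/(val (Ordinal kN')) -[j]/(val (Ordinal (leq_ltn_trans jk kN'))).
by rewrite entryE mxE.
Qed.

(** The sum telescopes, since -j/(k(k+1)) = j/(k+1) - j/k. *)
Lemma sum_OHM_coef (R : realType) j n : (0 < j < n)%N ->
  \sum_(j <= k < n) OHM_coef R k j = j%:R / n%:R.
Proof.
case: n => [|n]; first by rewrite andbF.
rewrite ltnS => /andP[j0]; elim: n => [|n IH] jn; first by lia.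
have [jn'|nj] := leqP j n; last first.
  have -> : j = n.+1 by lia.
  by rewrite big_nat1 /OHM_coef ltnn eqxx.
rewrite big_nat_recr //= IH // /OHM_coef ltnS jn' natrM.
by field; rewrite -natrD nat1r !pnatr_eq0.
Qed.

Lemma OHM_trig (R : realType) N : is_trig_mx (OHM R N).
Proof.
by apply/is_trig_mxP => i j ij; rewrite mxE /= !ifF //; lia.
Qed.

(** For b = 1, row [N'] is the last one, and the gluing prescribes it entirely. *)
Lemma gluing_OHM_eq (R : realType) N N' (H1 : 'M[R]_(N'.-1))
    (H2 : 'M[R]_((N - N').-1)) (H : 'M[R]_(N.-1)) :
  is_gluing N N' H1 H2 H -> (N - N' = 1)%N -> H1 = OHM R N' -> H = OHM R N.
Proof.
move=> [[/andP[N'0 N'N] _ _ tH] [[e1 _ _ e4] [e5 _]]] N1 eH1; rewrite {}eH1 in e1 e4.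
apply/matrixP => i j; have [ij|ji] := ltnP i j.
  by move/is_trig_mxP: tH => /(_ i j ij) ->; move/is_trig_mxP: (OHM_trig R N) => ->.
have iN := ltn_ord i; rewrite -!entryE [RHS]entry_OHM; [|lia..].
have [iN'|] := ltnP i.+1 N'; first by rewrite e1 ?entry_OHM; lia || done.
move=> N'i; have Ei : i.+1 = N' by lia.
rewrite Ei; have [jN'|] := ltnP j.+1 N'; last first.
  move=> N'j; have -> : j.+1 = N' by lia.
  rewrite e5 N1 muln1 /OHM_coef ltnn eqxx; congr (_ / _%:R); lia.
rewrite e4; last by lia.
rewrite (eq_big_nat _ _ (F2 := OHM_coef R ^~ j.+1)) => [|k jk]; last first.
  by rewrite entry_OHM; lia || done.
rewrite sum_OHM_coef ?jN' // N1 /OHM_coef jN'.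
have -> : N%:R = N'.+1%:R :> R by congr (_%:R); lia.
rewrite natrM; field; rewrite nat1r !pnatr_eq0; lia.
Qed.

(** * The bound on the square norm of basic matrices *)

(* With [E1] and [E2] the square norms of the two parts, all three subtracted  *)
(* terms are nonnegative, and the first one vanishes only for [y = 1].         *)
Lemma gluing_slack (R : realType) (x y E1 E2 : R) : 0 < x -> 0 < y ->
  (x + y) * ((x / (x + y)) ^+ 2 * (E1 + y^-1) + E2) =
  (2 * (x + y) ^+ 2 + 1) / 3
    - 2 * x * (y ^+ 2 - 1) * (2 * x + y) / (3 * (x + y) * y)
    - x / (x + y) * ((2 * x ^+ 2 + 1) / 3 - x * E1)
    - (x + y) / y * ((2 * y ^+ 2 + 1) / 3 - y * E2).
Proof.
move=> x0 y0; have xy0 : x + y != 0 by rewrite gt_eqF // addr_gt0.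
by field; rewrite xy0 gt_eqF.
Qed.

(** Induction through [gluing_slack]. In the case of equality, the first slack forces b = 1 and the
    second forces equality for [H1], which is then OHM; [gluing_OHM_eq] concludes. *)
Lemma basic_sqnorm_le (R : realType) N (H : 'M[R]_(N.-1)) : basic N H ->
  N%:R * sqnorm N H <= (2 * N%:R ^+ 2 + 1) / 3 /\
  (N%:R * sqnorm N H = (2 * N%:R ^+ 2 + 1) / 3 -> H = OHM R N).
Proof.
elim=> {N H} [|N a H1 H2 H _ [le1 eq1] bH2 [le2 _] gl].
  rewrite sqnorm1 //; split; first lra.
  by move=> _; apply/matrixP; case.
have s2 := basic_sum_normalized bH2.
rewrite (sqnorm_gluing gl s2).
have [[/andP[a0 aN] _ _ _] _] := gl.
have aNW : (a <= N)%N by lia.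
have x1 : 1 <= a%:R :> R by rewrite ler1n.
have y1 : 1 <= (N - a)%:R :> R by rewrite ler1n subn_gt0; lia.
have eN : N%:R = a%:R + (N - a)%:R :> R by rewrite -natrD subnKC.
rewrite eN gluing_slack ?(lt_le_trans ltr01) //.
have x0 : 0 < a%:R :> R by apply: lt_le_trans x1.
move: y1; set y := (N - a)%:R => y1; have y0 : 0 < y by apply: lt_le_trans y1.
set x := a%:R in x1 x0 le1 eq1 eN *.
set s1 := 2 * x * _ * _ / _; set s2' := x / _ * _; set s3 := _ / y * _.
have [x0' y0'] := (ltW x0, ltW y0).
have p1 : 0 <= s1.
  have y2 : 0 <= y ^+ 2 - 1 by rewrite subr_ge0 exprn_ege1.
  by rewrite /s1 divr_ge0 // !mulr_ge0 // ?addr_ge0 // ?mulr_ge0.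
have p2 : 0 <= s2'.
  by rewrite mulr_ge0 ?divr_ge0 ?subr_ge0 ?addr_ge0.
have p3 : 0 <= s3.
  by rewrite mulr_ge0 ?divr_ge0 ?subr_ge0 ?addr_ge0.
split; first by lra.
move=> e; have {}p1 : s1 = 0 by lra.
have {p3}p2 : s2' = 0 by lra.
have xy0 : x + y != 0 by rewrite gt_eqF // addr_gt0.
apply: (gluing_OHM_eq gl).
  (* All other factors of [s1] are positive. *)
  have : y ^+ 2 - 1 = 0.
    move/eqP: p1; rewrite /s1 !mulf_eq0 invr_eq0 !mulf_eq0 (negbTE xy0).
    rewrite (gt_eqF x0) (gt_eqF y0) !pnatr_eq0 /= !orbF.
    rewrite (gt_eqF (_ : 0 < 2 * x + y)) ?orbF => [/eqP //|].
    by rewrite addr_gt0 // mulr_gt0.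
  move/eqP; rewrite subr_eq0 sqrf_eq1 -addr_eq0.
  rewrite [X in _ || X]gt_eqF ?addr_gt0 // orbF /y -[1]/(1%:R) eqr_nat.
  by move/eqP.
apply: eq1; move/eqP: p2; rewrite /s2' !mulf_eq0 invr_eq0 (negbTE xy0) (gt_eqF x0) /=.
by rewrite subr_eq0 => /eqP.
Qed.

(** * OHM as an iterated gluing, and its certificates *)

Lemma gluing_OHM (R : realType) n : (0 < n)%N ->
  Hstar n (OHM R n) -> Hstar (n.+1 - n) (OHM R (n.+1 - n)) ->
  is_gluing n.+1 n (OHM R n) (OHM R (n.+1 - n)) (OHM R n.+1).
Proof.
move=> n0 h1 h2; have n1 : (n.+1 - n = 1)%N by lia.
split; first by split=> //; [lia|exact: OHM_trig].
have eqnn : entry (OHM R n.+1) n n = n%:R / n.+1%:R.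
  by rewrite entry_OHM ?n0 //= /OHM_coef ltnn eqxx.
split; last first.
  rewrite n1 muln1; split=> // m /andP[m0 m1].
  have -> : m = 1%N by lia.
  rewrite Q1_nat //= big_nat1 eqnn bin0 mulr1 !natrM.
  by field; rewrite nat1r pnatr_eq0.
split=> [k j jk kn|k j jk kn|k j jn kn|j jn].
- by rewrite !entry_OHM; lia || done.
- by lia.
- by lia.
- rewrite entry_OHM; [|lia..].
  rewrite (eq_big_nat _ _ (F2 := OHM_coef R ^~ j)) => [|k jk]; last first.
    by rewrite entry_OHM; lia || done.
  rewrite sum_OHM_coef; last by lia.
  rewrite /OHM_coef ifT; last by lia.
  by rewrite n1 natrM; field; rewrite nat1r !pnatr_eq0; lia.
Qed.

Lemma basic_OHM (R : realType) N : (forall n, (0 < n)%N -> Hstar n (OHM R n)) ->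
  (0 < N)%N -> basic N (OHM R N).
Proof.
move=> hOHM; have basic1 n (H : 'M[R]_(n.-1)) : n = 1%N -> basic n H.
  move=> n1; subst n; have -> : H = 0 by apply/matrixP; case.
  exact: basic_empty.
elim: N => // -[|N] IH _; first exact: basic1.
have N1 : (N.+2 - N.+1 = 1)%N by lia.
apply: (basic_gluing (IH isT) (basic1 _ _ N1)).
by apply: gluing_OHM => //; apply: hOHM; rewrite ?N1.
Qed.

(** Gluing the empty matrix to the right of size n multiplies the old polynomials by (n/(n+1)) x and
    inserts (n/(n+1)) (x - 1) at index n. *)
Lemma genpoly_OHM (R : realType) N j :
  (forall n, (0 < n)%N -> Hstar n (OHM R n)) -> (0 < j < N)%N ->
  genpoly N (OHM R N) j = (j%:R / N%:R) *: ('X^(N - j) - 'X^(N - j.+1)).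
Proof.
move=> hOHM; elim: N => [|n IH]; first by rewrite andbF.
move=> /andP[j0 jn]; have n0 : (0 < n)%N by lia.
have n1 : (n.+1 - n = 1)%N by lia.
have gl : is_gluing n.+1 n (OHM R n) (OHM R (n.+1 - n)) (OHM R n.+1).
  by apply: gluing_OHM => //; apply: hOHM; rewrite ?n1.
have [jn'|nj] := ltnP j n; last first.
  have -> : j = n by lia.
  by rewrite (genpoly_gluing_mid gl) n1 invr1 scale1r geom1 subnn expr0.
rewrite (genpoly_gluing_left gl) ?j0 //; last exact: sum_normalized1.
rewrite IH ?j0 // n1 expr1 -scalerAr scalerA mulrBr -!exprS -!subSn //.
congr (_ *: _); field; rewrite nat1r !pnatr_eq0; lia.
Qed.

Lemma dotp_Xn (R : realType) d p q :
  dotp d 'X^p 'X^q = ((p == q) && (p < d)%N)%:R :> R.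
Proof.
rewrite /dotp; under eq_bigr do rewrite !coefXn -natrM mulnb.
have [pd|dp] := ltnP p d; last first.
  rewrite andbF big1 // => i _; rewrite ltn_eqF //.
  exact: leq_trans (ltn_ord i) dp.
rewrite andbT (bigD1 (Ordinal pd)) //= eqxx /= big1 ?addr0 // => i.
by rewrite -val_eqE /= => /negbTE ->.
Qed.

Lemma cert_OHM (R : realType) N k j :
  (forall n, (0 < n)%N -> Hstar n (OHM R n)) -> (0 < j < k)%N -> (k <= N)%N ->
  cert N (OHM R N) k j = if k == j.+1 then (j * k)%:R / N%:R else 0.
Proof.
move=> hOHM /andP[j0 jk] kN.
have N0 : N%:R != 0 :> R by rewrite pnatr_eq0; lia.
rewrite cert_dotp ?jk // genpoly_OHM ?j0 ?(leq_trans jk) //.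
(* The factor [(k < N)%N%:R] unifies both cases: at [k = N] the lower monomial is absent, while the
   truncated exponent [N - k.+1] would make it 1. *)
have -> : genpoly N (OHM R N) k =
    (k%:R / N%:R) *: ('X^(N - k) - (k < N)%N%:R *: 'X^(N - k.+1)).
  have [kN'|Nk] := ltnP k N; last first.
    have -> : k = N by lia.
    by rewrite genpolyN subnn expr0 scale0r subr0 divff // scale1r.
  by rewrite genpoly_OHM ?kN' ?scale1r // (leq_trans j0) // ltnW.
rewrite dotpZl dotpZr dotpBl !dotpBr !dotpZr !dotp_Xn.
have -> : (N - j == N - k)%N = false by lia.
have -> : (N - j == N - k.+1)%N = false by lia.
have -> : (N - j.+1 == N - k)%N = (k == j.+1) by lia.
have -> : (N - j.+1 < N)%N by lia.
have -> : (k < N)%N%:R * ((N - j.+1 == N - k.+1)%N && true)%:R = 0 :> R.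
  have [kN'|Nk] := ltnP k N; last by rewrite mul0r.
  have -> : (N - j.+1 == N - k.+1)%N = false by lia.
  by rewrite mulr0.
by case: eqP => _ /=; rewrite ?natrM; field.
Qed.

(** * Optimality of OHM *)

Lemma dot_sym (R : realType) (X : lmodType R) (f : {dot X for idfun}) u v :
  f u v = f v u.
Proof. by rewrite hermC expr0 mul1r. Qed.

Lemma dot_scalel (R : realType) (X : lmodType R) (f : {dot X for idfun}) c u v :
  f (c *: u) v = c * f u v.
Proof. by rewrite linearZl_LR. Qed.

Lemma dot_scaler (R : realType) (X : lmodType R) (f : {dot X for idfun}) c u v :
  f u (c *: v) = c * f u v.
Proof. by rewrite dot_sym dot_scalel dot_sym. Qed.

(** This is the Halpern form y_{k+1} = y_0/(k+2) + (k+1)/(k+2) T y_k with denominators cleared. *)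
Lemma OHM_step (R : realType) N (X : completeNormedModType R) (T : X -> X) y k :
  generates N (OHM R N) T y -> (k < N.-1)%N ->
  k.+2%:R *: (y k.+1 - y 0%N) = k.+1%:R *: (y k - y 0%N - (y k - T (y k))).
Proof.
move=> gen; pose r j := y j - T (y j).
(* The step at [m] follows from a closed form of y_m - y_0, which [inv] below establishes
   inductively by means of this very step. *)
have step m : (m < N.-1)%N ->
    m.+1%:R *: (y m - y 0%N) = - \sum_(0 <= j < m) j.+1%:R *: r j ->
    m.+2%:R *: (y m.+1 - y 0%N) = m.+1%:R *: (y m - y 0%N - r m).
  move=> mN inv; rewrite gen // big_nat_recr //= -/(r m).
  rewrite (eq_big_nat _ _
    (F2 := fun j => - (m.+2%:R^-1 *: (m.+1%:R^-1 *: (j.+1%:R *: r j))))); last first.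
    move=> j /andP[_ jm]; rewrite entry_OHM; [|lia..].
    rewrite /OHM_coef ltnS jm scaleNr -/(r j) !scalerA natrM; congr (- (_ *: _)).
    by field; rewrite -natrD nat1r !pnatr_eq0.
  rewrite entry_OHM; [|lia..].
  rewrite /OHM_coef ltnn eqxx sumrN -!scaler_sumr -scalerN -scalerN -inv.
  rewrite [m.+1%:R^-1 *: (_ *: _)]scalerA mulVf ?pnatr_eq0 // scale1r.
  rewrite addrAC [LHS]scalerBr [X in _ - X]scalerDr !scalerA.
  rewrite mulfV ?pnatr_eq0 // scale1r mulrCA mulfV ?pnatr_eq0 // mulr1.
  rewrite opprD addrA [RHS]scalerBr; congr (_ - _).
  by rewrite -[m.+2%:R]natr1 scalerDl scale1r addrK.
have inv m : (m <= N.-1)%N ->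
    m.+1%:R *: (y m - y 0%N) = - \sum_(0 <= j < m) j.+1%:R *: r j.
  elim: m => [|m IH] mN; first by rewrite subrr scaler0 big_geq // oppr0.
  by rewrite step ?IH // ?(ltnW mN) // scalerBr IH ?(ltnW mN) // big_nat_recr //= opprD.
by move=> kN; apply: step => //; apply: inv; apply: ltnW.
Qed.

(** With w = x - y and v the difference of residuals, T x - T y = w - v; expand |w - v|^2 <=
    |w|^2. *)
Lemma nonexpansive_dot (R : realType) (X : completeNormedModType R)
    (f : {dot X for idfun}) (T : X -> X) x y :
  (forall x, f x x = `|x| ^+ 2) -> nonexpansive T ->
  f ((x - T x) - (y - T y)) ((x - T x) - (y - T y)) <=
    2 * f (x - y) ((x - T x) - (y - T y)).
Proof.
move=> fE nT; set v := _ - (y - T y).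
have : f (x - y - v) (x - y - v) <= f (x - y) (x - y).
  rewrite !fE lerXn2r ?nnegrE // (_ : _ - v = T x - T y) ?nT //.
  by rewrite /v opprB !addrA subrK opprB addrC addrA subrK.
move: v (x - y) => {x y} v w; rewrite linearBl !linearBr /= (dot_sym f v w); lra.
Qed.

(** Let v be the last residual. The Lyapunov bound gives (N-1)|v|^2 + 2<y_{N-1} - y_0, v> <= 0, and
    comparison with the fixed point z gives |v|^2 <= 2<y_{N-1} - z, v>. Together, N|v|^2 <= 2<y_0 -
    z, v>, and Cauchy-Schwarz finishes. *)
Lemma Hstar_OHM (R : realType) N : (0 < N)%N -> Hstar N (OHM R N).
Proof.
move=> N0; split=> [|X [f fE] T nT z Tz y gen]; first exact: OHM_trig.
pose u k := y k - T (y k); pose d k := y k - y 0%N.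
have fB a b c e : f (a - b) (c - e) = f a c - f a e - (f b c - f b e).
  by rewrite linearBl !linearBr.
(* [(k + 1) (k |u_k|^2 + 2 <y_k - y_0, u_k>)] is nonincreasing in [k]. *)
have lyap k : (k <= N.-1)%N ->
    k.+1%:R * (k%:R * f (u k) (u k) + 2 * f (d k) (u k)) <= 0.
  elim: k => [|k IH] kN.
    by rewrite mul0r add0r /d subrr linear0l mulr0 mulr0.
  apply: le_trans (IH (ltnW kN)).
  have := OHM_step gen kN; rewrite -/(d _) -/(d _) -/(u _) => eqd.
  have eqf w : k.+2%:R * f (d k.+1) w = k.+1%:R * (f (d k) w - f (u k) w).
    by rewrite -dot_scalel eqd dot_scalel linearBl.
  have := nonexpansive_dot (y k.+1) (y k) fE nT; rewrite -/(u _) -/(u _).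
  have -> : y k.+1 - y k = d k.+1 - d k by rewrite /d opprB addrA subrK.
  rewrite (fB (u k.+1) (u k)) (fB (d k.+1) (d k)) (dot_sym f (u k.+1) (u k)).
  have := eqf (u k); have := eqf (u k.+1).
  set n := k.+1%:R; have n0 : 0 < n :> R by rewrite ltr0n.
  have -> : k.+2%:R = n + 1 :> R by rewrite -natr1.
  have -> : k%:R = n - 1 :> R by rewrite /n -natr1 addrK.
  set a := f (u k) (u k); set b := f (u k) (u k.+1); set c := f (u k.+1) (u k.+1).
  set p := f (d k) (u k); set q := f (d k) (u k.+1).
  set s := f (d k.+1) (u k.+1); set t := f (d k.+1) (u k).
  clearbody n a b c p q s t => e1 e2 h; have n1 : n + 1 != 0 by rewrite gt_eqF ?addr_gt0.
  have qE : q = (n + 1) * s / n + b.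
    by rewrite e1 [n * _]mulrC mulfK ?subrK // gt_eqF.
  have tE : t = n * (p - a) / (n + 1) by rewrite -e2 [_ * t]mulrC mulfK.
  (* The decrease is exactly n(n+1) times the slack of [nonexpansive_dot] between consecutive
     iterates. *)
  rewrite -subr_ge0 (_ : _ - _ = n * (n + 1) *
    (2 * (s - t - (q - p)) - (c - b - (b - a)))); last first.
    by rewrite qE tE; field; rewrite n1 gt_eqF.
  by rewrite mulr_ge0 ?subr_ge0 // mulr_ge0 ?addr_ge0 // ltW.
have := lyap N.-1 (leqnn _); set v := u N.-1; rewrite prednK //.
rewrite pmulr_rle0 ?ltr0n // => {lyap} hv.
have := nonexpansive_dot (y N.-1) z fE nT; rewrite Tz subrr subr0 -/(u _) -/v => hz.
pose w := y 0%N - z.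
have ez : y N.-1 - z = d N.-1 + w by rewrite /d /w addrA subrK.
have eD : f (d N.-1 + w) v = f (d N.-1) v + f w v by rewrite linearDl.
rewrite ez eD in hz.
(* This square plays the role of Cauchy-Schwarz; it vanishes exactly when N v = 2 w. *)
have := sqr_ge0 `|2 *: w - N%:R *: v|; rewrite -(fE (2 *: w - N%:R *: v)).
rewrite (fB (2 *: w) (N%:R *: v)) !dot_scalel !dot_scaler (dot_sym f v w) => hw.
rewrite -/(u _) -/v -/w -!fE.
have N0' : 0 < N%:R :> R by rewrite ltr0n.
rewrite ler_pdivlMr ?exprn_gt0 //.
move: hv; have -> : N.-1%:R = N%:R - 1 :> R by rewrite -[in RHS](prednK N0) -natr1 addrK.
move: hz hw; set a := f v v; set b := f w v; set c := f w w; set e := f (d N.-1) v.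
move: N0'; set n := N%:R.
clearbody n a b c e => n0 hz hw hv.
have {hz hv} : 0 <= n * (2 * b - n * a) by rewrite mulr_ge0 ?(ltW n0) //; lra.
by lra.
Qed.

Theorem proposition8 (R : realType) (N : nat) (hN : (2 <= N)%N) :
  rho N (OHM R N) = \sum_(1 <= j < N) cert N (OHM R N) j.+1 j /\
  \sum_(1 <= j < N) cert N (OHM R N) j.+1 j = (N%:R ^+ 2 - 1) / 3 /\
  unique_maximizer
    [set H : 'M[R]_(N.-1) | basic N H /\ optimal_vertex N H]
    (rho N) (OHM R N).
Proof.
have N0 : (0 < N)%N by apply: ltn_trans hN.
have N0' : N%:R != 0 :> R by rewrite pnatr_eq0 -lt0n.
have certE k j : (0 < j < k)%N -> (k <= N)%N ->
    cert N (OHM R N) k j = if k == j.+1 then (j * k)%:R / N%:R else 0.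
  by apply: cert_OHM; exact: Hstar_OHM.
have rhoE : rho N (OHM R N) = \sum_(1 <= j < N) cert N (OHM R N) j.+1 j.
  apply: eq_big_nat => j /andP[j0 jN]; rewrite big_ltn //.
  rewrite big_nat big1 ?addr0 // => k /andP[jk kN].
  by rewrite certE ?gtn_eqF ?j0 // ltnW.
have sumE : \sum_(1 <= j < N) cert N (OHM R N) j.+1 j = (N%:R ^+ 2 - 1) / 3.
  rewrite (eq_big_nat _ _ (F2 := fun j => (j * j.+1)%:R / N%:R)); last first.
    by move=> j /andP[j0 jN]; rewrite certE ?j0 ?eqxx /=.
  rewrite -mulr_suml.
  have -> : \sum_(1 <= j < N) (j * j.+1)%:R = N%:R * (N%:R ^+ 2 - 1) / 3 :> R.
    elim: (N) N0 => // -[_ _|n IH _].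
      by rewrite big_geq // expr1n subrr mulr0 mul0r.
    by rewrite big_nat_recr //= IH // natrM; field.
  by field.
have bOHM : basic N (OHM R N) by apply: basic_OHM => //; exact: Hstar_OHM.
split=> //; split=> //; split.
  split=> //; split; first exact: Hstar_OHM.
  move=> j /andP[j0 jN]; exists j.+1; split.
    rewrite ltnSn jN; split=> //; rewrite certE ?j0 ?eqxx //=.
    by rewrite divr_gt0 // ltr0n // muln_gt0 j0.
  move=> k [/andP[jk kN]]; rewrite certE ?j0 //; case: eqP => // _.
  by rewrite ltxx.
(* By [rho_sqnorm], the bound (2N^2+1)/3 on N [sqnorm] corresponds to (N^2-1)/3 for rho. *)
move=> H [bH _] neq; rewrite rhoE sumE rho_sqnorm //; last exact: basic_sum_normalized.
have [le eq] := basic_sqnorm_le bH.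
have lt : N%:R * sqnorm N H < (2 * N%:R ^+ 2 + 1) / 3.
  by rewrite lt_neqAle le andbT; apply/eqP => /eq.
lra.
Qed.
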